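(* Let $K$ be a Cantor set, let $T:K\to K$ be a homeomorphism, and let $K_1,\dots,K_N$ be pairwise disjoint Cantor sets with $K=\bigcup_{i=1}^N K_i$. Then there exists a homeomorphism $\widetilde T:K\to K$ such that for every $x\in K$ and every $1\le i\le N$, $\widetilde T(x)\in K_i$ if and only if $T(x)\in K_i$, and for every $x\in K$ the $\omega$-limit set of $x$ under $\widetilde T$ is a periodic orbit.
   Context: A Cantor set is a nonempty totally disconnected, perfect, compact metric space. *)

(* Defs.v *)
From HB Require Import structures.
From mathcomp Require Import all_boot all_order all_algebra.
From mathcomp Require Import all_classical all_reals all_analysis.
Set Implicit Arguments. Unset Strict Implicit. Unset Printing Implicit Defensive.
Import Order.TTheory GRing.Theory Num.Theory.
Local Open Scope classical_set_scope.

Definition is_cantor_set {T : topologicalType} (A : set T) : Prop :=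
  [/\ A !=set0, compact A, perfect_set A & totally_disconnected A].

Definition homeomorphism {T : topologicalType} (f : T -> T) : Prop :=
  exists g : T -> T, [/\ cancel f g, cancel g f, continuous f & continuous g].

Definition omega_limit {T : topologicalType} (f : T -> T) (x : T) : set T :=
  [set y | forall U, nbhs y U -> forall m : nat, exists2 n : nat, (m <= n)%N & U (iter n f x)].

Definition periodic_orbit {T : topologicalType} (f : T -> T) (S : set T) : Prop :=
  exists p : T, exists2 k : nat, (0 < k)%N & iter k f p = p /\ S = range (fun n => iter n f p).

(* Main.v *)
Require Import Defs.
From HB Require Import structures.
From mathcomp Require Import all_boot all_order all_algebra.
From mathcomp Require Import all_classical all_reals all_analysis zify.
Set Implicit Arguments.
Unset Strict Implicit.
Unset Printing Implicit Defensive.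
Import Order.TTheory GRing.Theory Num.Theory.
Local Open Scope classical_set_scope.

(** Let [s] and [t] be locally constant surjections of a Cantor set [K] onto a
finite set [V]; for the theorem, [s] tells which [K_i] contains the point and
[t := s \o T]. A map [f] with [s \o f = t] moves along the edges [(s x, t x)] of
a finite directed graph on [V]. Every vertex has an outgoing and an incoming
edge, so we may choose a successor and a predecessor of each vertex. Consider
the bi-infinite walks which follow the predecessors backwards up to some edge
and the successors forwards after it, together with their limits. They form a
closed shift-invariant set, each edge is crossed at time [0] by one of them, and
each of them is eventually periodic because the successor and the predecessor
act on a finite set. Multiply this subshift by the Cantor space, with the shift
acting trivially on the second factor. For each edge, the points of [K] which
have to follow it and the points of the product whose walk crosses it at time
[0] both form Cantor sets, hence are homeomorphic; gluing these homeomorphisms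
over the finitely many edges conjugates the product to the desired [f]. *)

(** * Total disconnectedness and zero-dimensionality *)

Lemma zero_dimensional_hausdorff (T : topologicalType) :
  zero_dimensional T -> hausdorff_space T.
Proof.
move=> zdT x y xy; apply: contrapT => /eqP /zdT[U [[oU cU] Ux nUy]].
have [z []//] := xy U (~` U) (open_nbhs_nbhs (conj oU Ux))
  (open_nbhs_nbhs (conj (closed_openC cU) nUy)).
Qed.

Lemma compact_cluster_sub_open (T : topologicalType) (F : set_system T)
    (O : set T) : compact [set: T] -> Filter F -> open O ->
  cluster F `<=` O -> F O.
Proof.
move=> cT FF oO clO; apply: contrapT => nFO.
have FCO : ProperFilter (within (~` O) F).
  split; last exact: within_filter.
  rewrite /within/= => F0; apply: nFO.
  by apply: filterS F0 => z; exact: contrapT.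
have [z [_ clz]] := cT _ FCO filterT.
have Oz : O z.
  apply: clO => A B FA zB; apply: clz => //.
  by apply: filterS FA => ? ? _.
by have [y []] := clz _ O (withinT (~` O) FF) (open_nbhs_nbhs (conj oO Oz)).
Qed.

Lemma separated_closedl (T : topologicalType) (A B : set T) :
  separated A B -> closed (A `|` B) -> closed A.
Proof.
move=> [clAB _] cAB; apply/closure_id/seteqP; split=> [|z clAz].
  exact: subset_closure.
have : (A `|` B) z.
  by rewrite ((closure_id _).1 cAB); exact: (closureS (@subsetUl _ A B)).
by case=> // Bz; have : (closure A `&` B) z by []; rewrite clAB.
Qed.

Section quasi_component.
Context (T : topologicalType) (x : T).

Definition clopen_nbhs : set_system T := [set D | clopen D /\ D x].

Definition clopen_filter : set_system T := filter_from clopen_nbhs id.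

Definition quasi_component : set T := \bigcap_(D in clopen_nbhs) D.

Lemma clopen_filter_filter : Filter clopen_filter.
Proof.
apply: filter_from_filter; first by exists setT; split => //; exact: clopenT.
by move=> A B [? ?] [? ?]; exists (A `&` B) => //; split=> //; exact: clopenI.
Qed.

Lemma cluster_clopen_filter : cluster clopen_filter = quasi_component.
Proof.
rewrite clusterE; apply/seteqP; split=> z clz; last first.
  by move=> A [D clD DA]; apply: subset_closure; apply: DA; exact: clz.
move=> D [[oD cD] Dx]; rewrite (closure_id D).1//.
by apply: clz; exists D.
Qed.

Lemma quasi_component_refl : quasi_component x. Proof. by move=> D []. Qed.

Lemma closed_quasi_component : closed quasi_component.
Proof. by apply: closed_bigI => D [[]]. Qed.

Hypotheses (hT : hausdorff_space T) (cT : compact [set: T]).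

Lemma quasi_component_sub_open (O : set T) : open O ->
  quasi_component `<=` O -> exists D, [/\ clopen D, D x & D `<=` O].
Proof.
rewrite -cluster_clopen_filter => oO clO.
have [D [clD Dx] DO] := compact_cluster_sub_open cT clopen_filter_filter oO clO.
by exists D.
Qed.

Lemma quasi_component_closed_setU (B C : set T) : closed B -> closed C ->
  B `&` C = set0 -> quasi_component = B `|` C -> B x -> C = set0.
Proof.
move=> cB cC BC0 QBC Bx.
have BnC : set_nbhs B (~` C).
  move=> b Bb; apply: open_nbhs_nbhs; split; first exact: closed_openC.
  by move=> Cb; have : (B `&` C) b by []; rewrite BC0.
have [V nV VnC] := compact_normal hT cT cB BnC.
have BV : B `<=` V° by move=> b /nV.
have clVnC : closure V° `<=` ~` C.
  by apply: subset_trans VnC; exact: (closureS (@interior_subset _ V)).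
have [||D [[oD cD] Dx DV]] :=
    @quasi_component_sub_open (V° `|` ~` (closure V°)).
- by apply: openU; [exact: open_interior|exact/closed_openC/closed_closure].
- by rewrite QBC => z [/BV|Cz]; [left|right => /clVnC].
have DVcl : D `&` V° = D `&` closure V°.
  apply/seteqP; split=> z [Dz Vz]; split => //; first exact: subset_closure.
  by have [] := DV z Dz.
have QDV : quasi_component `<=` D `&` V°.
  apply: bigcap_inf; split; last by split => //; exact: BV.
  split; first by apply: openI => //; exact: open_interior.
  by rewrite DVcl; apply: closedI => //; exact: closed_closure.
rewrite -subset0 => z Cz; have [_ Vz] : (D `&` V°) z.
  by apply: QDV; rewrite QBC; right.
exact: (clVnC z (subset_closure Vz)).
Qed.

Lemma connected_quasi_component : connected quasi_component.
Proof.
apply/connectedP => E [E0 QE sepE].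
have cQ : closed (E false `|` E true).
  by rewrite -QE; exact: closed_quasi_component.
have cEf : closed (E false) by exact: separated_closedl sepE cQ.
have cEt : closed (E true).
  by apply: (@separated_closedl _ _ (E false)); rewrite 1?separatedC 1?setUC.
have Eft0 : E false `&` E true = set0 by exact: separated_disjoint.
have : (E false `|` E true) x by rewrite -QE; exact: quasi_component_refl.
case=> [Efx|Etx].
- have [y] := E0 true.
  by rewrite (quasi_component_closed_setU cEf cEt Eft0 QE Efx).
- have [y] := E0 false.
  rewrite setIC in Eft0; rewrite setUC in QE.
  by rewrite (quasi_component_closed_setU cEt cEf Eft0 QE Etx).
Qed.

End quasi_component.

Lemma totally_disconnected_zero_dimensional (T : topologicalType) :
  hausdorff_space T -> compact [set: T] -> totally_disconnected [set: T] ->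
  zero_dimensional T.
Proof.
move=> hT cT tdT x y xy; apply: contrapT => nD.
have : connected_component [set: T] x y.
  exists (quasi_component x).
    split => //; first exact: quasi_component_refl.
    exact: connected_quasi_component.
  by move=> D [clD Dx]; apply: contrapT => nDy; apply: nD; exists D.
by rewrite tdT// => yx; move: xy; rewrite yx eqxx.
Qed.

(** * Cantor-like spaces with labelled points *)

Definition homeomorphism_pair (X Y : topologicalType)
    (h : X -> Y) (k : Y -> X) :=
  [/\ cancel h k, cancel k h, continuous h & continuous k].

Lemma homeomorphism_conjugate (X Y : topologicalType) (h : X -> Y) (k : Y -> X)
    (f : Y -> Y) :
  homeomorphism_pair h k -> homeomorphism f -> homeomorphism (k \o f \o h).
Proof.
move=> [hK kK ch ck] [g [fK gK cf cg]].
have conj_continuous u : continuous u -> continuous (k \o u \o h).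
  move=> cu x; apply: continuous_comp; first exact: ch.
  by apply: continuous_comp; [exact: cu|exact: ck].
exists (k \o g \o h); split; try exact: conj_continuous.
- by move=> x /=; rewrite kK fK hK.
- by move=> x /=; rewrite kK gK hK.
Qed.

Definition locally_constant (X : topologicalType) (I : Type) (a : X -> I) :=
  forall x, \forall z \near x, a z = a x.

Lemma locally_constant_comp (X Y : topologicalType) I
    (f : X -> Y) (a : Y -> I) :
  continuous f -> locally_constant a -> locally_constant (a \o f).
Proof. by move=> cf la x; exact: cf (la (f x)). Qed.

Lemma locally_constant_pair (X : topologicalType) I J
    (a : X -> I) (b : X -> J) :
  locally_constant a -> locally_constant b ->
  locally_constant (fun x => (a x, b x)).
Proof. by move=> la lb x; apply: filterS2 (la x) (lb x) => z -> ->. Qed.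

Lemma clopen_locally_constant (X : topologicalType) I (a : X -> I) (D : set I) :
  locally_constant a -> clopen (a @^-1` D).
Proof.
move=> la.
have openD E : open (a @^-1` E).
  rewrite openE => x Ex; apply: filterS (la x) => z.
  by rewrite /preimage/= => ->.
by split=> //; rewrite -openC; exact: (openD (~` D)).
Qed.

Lemma continuous_locally_constant_comp (X Y Z : topologicalType) I
    (a : X -> I) (f : X -> Y) (g : I -> Y -> Z) :
  locally_constant a -> continuous f ->
  (forall x, {for f x, continuous (g (a x))}) ->
  continuous (fun x => g (a x) (f x)).
Proof.
move=> la cf cg x U /(cg x)/(cf x); move: (la x); apply: filterS2 => z az.
by rewrite /= az.
Qed.

Lemma partition_locally_constant (X : topologicalType) (I : finType)
    (A : I -> set X) :
  (forall i, closed (A i)) -> trivIset [set: I] A -> \bigcup_i A i = [set: X] ->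
  exists2 l : X -> I, forall x i, A i x <-> l x = i & locally_constant l.
Proof.
move=> cA /trivIsetP dA covA.
have /choice[l lA] x : exists i, A i x.
  by have : [set: X] x by []; rewrite -covA => -[i _ ?]; exists i.
have lE x i : A i x <-> l x = i.
  split=> [Aix|<-//]; apply: contrapT => /eqP lxi.
  by have : (A (l x) `&` A i) x by []; rewrite dA.
exists l => // x.
have closed_others : closed (\bigcup_(i in [set i | i <> l x]) A i).
  by apply: closed_bigcup => //; exact: finite_finset.
have : nbhs x (~` \bigcup_(i in [set i | i <> l x]) A i).
  apply: open_nbhs_nbhs; split; first exact: closed_openC.
  by move=> [i /= il /lE li]; exact: il.
apply: filterS => z z_other; apply: contrapT => lzx.
by apply: z_other; exists (l z).
Qed.

Section set_type.
Context (X : topologicalType) (A : set X).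

Lemma cvg_set_val (F : set_system A) (a : A) :
  Filter F -> \val x @[x --> F] --> \val a -> F --> a.
Proof.
move=> FF Fa U [_ [[W oW <-] Wa WU]]; apply: (filterS WU); apply: (Fa W).
exact: open_nbhs_nbhs.
Qed.

Lemma compact_set_type : compact A -> compact [set: A].
Proof.
move=> cA F FF _.
have [|p [Ap clp]] := cA (set_val @ F) _.
  by apply: (@filterS _ F _ setT) => [a _|]; [exact: set_valP|exact: filterT].
exists (SigSub (mem_set Ap) : A); split => // B C FB [_ [[W oW <-] Wp WC]].
have [|_ [[b Bb <-] Wb]] :=
    clp (set_val @` B) W _ (open_nbhs_nbhs (conj oW Wp)).
  by apply: (@filterS _ F _ B) => // b Bb; exists b.
by exists b; split => //; exact: WC.
Qed.

Lemma zero_dimensional_set_type : zero_dimensional X -> zero_dimensional A.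
Proof.
move=> zX x y xy.
have /zX[U [clU Ux nUy]] : \val x != \val y by rewrite (inj_eq val_inj).
exists (set_val @^-1` U); split => //; apply: preimage_clopen => //.
exact: initial_continuous.
Qed.

Lemma perfect_set_type : open A -> perfect_set [set: X] -> perfect_set [set: A].
Proof.
move=> oA /perfectTP pX; apply/perfectTP => x [W oW Wx]; apply: (pX (\val x)).
suff <- : W `&` A = [set \val x] by exact: openI.
apply/seteqP; split=> [y [Wy Ay]|_ ->]; last first.
  by split; [have : [set x] x by []; rewrite -Wx|exact: set_valP].
have : (set_val @^-1` W) (SigSub (mem_set Ay) : A) by [].
by rewrite Wx => /(congr1 set_val).
Qed.

Lemma cantor_like_set_type : clopen A -> cantor_like X -> cantor_like A.
Proof.
move=> [oA cA] [pX kX _ zX]; have zA := zero_dimensional_set_type zX.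
split=> //; first exact: perfect_set_type.
  by apply: compact_set_type; exact: subclosed_compact kX _.
exact: zero_dimensional_hausdorff.
Qed.

End set_type.

Lemma zero_dimensional_prod (X Y : topologicalType) :
  zero_dimensional X -> zero_dimensional Y -> zero_dimensional (X * Y)%type.
Proof.
move=> zX zY [x y] [x' y']; rewrite xpair_eqE negb_and => /orP[/zX|/zY].
  move=> [U [clU Ux nUx']]; exists (fst @^-1` U); split => //.
  by apply: preimage_clopen => // z; exact: cvg_fst.
move=> [U [clU Uy nUy']]; exists (snd @^-1` U); split => //.
by apply: preimage_clopen => // z; exact: cvg_snd.
Qed.

Lemma perfect_prod_snd (X Y : topologicalType) :
  perfect_set [set: Y] -> perfect_set [set: X * Y].
Proof.
move=> /perfectTP pY; apply/perfectTP => -[x y] /snd_open; rewrite image_set1.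
exact: pY.
Qed.

Lemma cantor_like_prod (X Y : topologicalType) :
  compact [set: X] -> zero_dimensional X -> cantor_like Y ->
  cantor_like (X * Y)%type.
Proof.
move=> kX zX [pY kY _ zY]; have zXY := zero_dimensional_prod zX zY.
split=> //; first exact: perfect_prod_snd.
  by rewrite -setXTT; exact: compact_setX.
exact: zero_dimensional_hausdorff.
Qed.

Lemma cantor_set_cantor_like (X : topologicalType) :
  hausdorff_space X -> is_cantor_set [set: X] -> cantor_like X.
Proof.
move=> hX [_ kX pX tdX]; split=> //.
exact: totally_disconnected_zero_dimensional.
Qed.

Lemma cantor_like_homeomorphic (R : realType) (X : pseudoMetricType R) :
  cantor_like X -> [set: X] !=set0 ->
  exists (h : cantor_space -> X) k, homeomorphism_pair h k.
Proof.
move=> cX [x0 _]; pose pX := isPointed.Build X x0.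
pose PX : pseudoPMetricType R := HB.pack X pX.
have [h [ch clh]] := @homeomorphism_cantor_like R PX cX.
have hK : cancel h h^-1%FUN by move=> c; apply: funK; exact: in_setT.
have hVK : cancel h^-1%FUN h by move=> x; apply: invK; exact: in_setT.
exists h, h^-1%FUN; split=> //; apply/continuous_closedP => B cB.
rewrite (_ : _ @^-1` B = h @` B); first exact: clh.
apply/seteqP; split => [x Bx|_ [c Bc <-]]; first by exists (h^-1%FUN x).
by rewrite /preimage/= hK.
Qed.

Section labelled_cantor.
Context (R : realType) (I : Type).

Lemma clopen_cantor_chart (X : pseudoMetricType R) (A : set X) :
  cantor_like X -> clopen A -> A !=set0 ->
  exists (g : cantor_space -> X) (f : X -> cantor_space),
    [/\ continuous g, {in A, continuous f}, forall c, A (g c),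
        cancel g f & {in A, cancel f g}].
Proof.
move=> cX clA [a Aa].
have [|h [k [hK kK ch ck]]] :=
    cantor_like_homeomorphic (cantor_like_set_type clA cX).
  by exists (SigSub (mem_set Aa)).
have fE (b : A) : valL_ point k (\val b) = k b.
  exact: (congr1 (@^~ b) (valLK point k)).
exists (set_val \o h), (valL_ point k); split.
- by move=> c; apply: continuous_comp; [exact: ch|exact: initial_continuous].
- rewrite -continuous_open_subspace; last by case: clA.
  exact/subspace_valL_continuousP.
- by move=> c; exact: set_valP.
- by move=> c; rewrite /comp fE hK.
- by move=> x Ax; rewrite /comp (fE (SigSub Ax)) kK.
Qed.

Lemma labelled_cantor_charts (X : pseudoMetricType R) (a : X -> I) :
  cantor_like X -> locally_constant a -> [set: X] !=set0 ->
  exists (g : I -> cantor_space -> X) (f : X -> cantor_space),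
    [/\ continuous f, forall x, g (a x) (f x) = x &
        forall i, range a i ->
          continuous (g i) /\ forall c, a (g i c) = i /\ f (g i c) = c].
Proof.
move=> cX la [x0 _].
have /choice[gf gfP] i : exists gf : (cantor_space -> X) * (X -> cantor_space),
    range a i -> [/\ continuous gf.1, {in a @^-1` [set i], continuous gf.2},
      forall c, a (gf.1 c) = i, cancel gf.1 gf.2 &
      {in a @^-1` [set i], cancel gf.2 gf.1}].
  have [[x _ axi]|] := pselect (range a i); last by exists (cst x0, cst point).
  have [|g [f gfP]] :=
      clopen_cantor_chart cX (clopen_locally_constant [set i] la).
    by exists x.
  by exists (g, f).
have rangea x : range a (a x) by exists x.
exists (fun i => (gf i).1), (fun x => (gf (a x)).2 x); split.
- apply: (@continuous_locally_constant_comp _ _ _ _ _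
    id (fun i => (gf i).2)) => // x.
    exact: cvg_id.
  by have [_ cf _ _ _] := gfP _ (rangea x); exact: (cf x (mem_set erefl)).
- by move=> x; have [_ _ _ _] := gfP _ (rangea x); apply; exact: mem_set.
- by move=> i /gfP[cg _ ag gK _]; split=> // c; rewrite ag gK.
Qed.

Lemma labelled_cantor_homeomorphism (X Y : pseudoMetricType R)
    (a : X -> I) (b : Y -> I) : cantor_like X -> cantor_like Y ->
  locally_constant a -> locally_constant b -> [set: X] !=set0 ->
  range a = range b ->
  exists h k, homeomorphism_pair h k /\ b \o h =1 a.
Proof.
move=> cX cY la lb [x0 _] rangeab.
have [y0 _ _] : range b (a x0) by rewrite -rangeab; exists x0.
have [|gX [fX [cfX fXK gXP]]] := labelled_cantor_charts cX la.
  by exists x0.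
have [|gY [fY [cfY fYK gYP]]] := labelled_cantor_charts cY lb.
  by exists y0.
have rangeb x : range b (a x) by rewrite -rangeab; exists x.
have rangea y : range a (b y) by rewrite rangeab; exists y.
exists (fun x => gY (a x) (fX x)), (fun y => gX (b y) (fY y)).
split; first split.
- by move=> x /=; have [_ /(_ (fX x))[-> ->]] := gYP _ (rangeb x).
- by move=> y /=; have [_ /(_ (fY y))[-> ->]] := gXP _ (rangea y).
- apply: (continuous_locally_constant_comp la cfX) => x.
  by have [cg _] := gYP _ (rangeb x); exact: cg.
- apply: (continuous_locally_constant_comp lb cfY) => y.
  by have [cg _] := gXP _ (rangea y); exact: cg.
- by move=> x /=; have [_ /(_ (fX x))[]] := gYP _ (rangeb x).
Qed.

End labelled_cantor.

(** * Asymptotically periodic points *)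

Lemma continuous_iter (X : topologicalType) (f : X -> X) n :
  continuous f -> continuous (iter n f).
Proof.
move=> cf; elim: n => [|n IHn] x; first exact: cvg_id.
by apply: (continuous_comp (IHn x)); exact: cf.
Qed.

Lemma cluster_residue (X : topologicalType) (u : nat -> X) k y :
  (0 < k)%N -> cluster (u @ \oo) y ->
  exists r, cluster (u (r + n * k)%N @[n --> \oo]) y.
Proof.
move=> k0 uy; apply: contrapT => /forallNP ny.
have /choice[AB ABP] (r : 'I_k) : exists AB : set X * set X,
    [/\ \forall n \near \oo, AB.1 (u (r + n * k)%N), nbhs y AB.2 &
        AB.1 `&` AB.2 = set0].
  have /existsNP[A /existsNP[B /not_implyP[uA /not_implyP[yB AB0]]]] := ny r.
  exists (A, B); split=> //=; rewrite -subset0 => z ABz.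
  by apply: AB0; exists z.
have [M _ MA] : \forall n \near \oo, forall r, (AB r).1 (u (r + n * k)%N).
  by apply: filter_forall => r; have [] := ABP r.
have nearB : \forall z \near y, forall r, (AB r).2 z.
  by apply: filter_forall => r; have [] := ABP r.
have [|_ [[n Mkn <-] Bn]] := uy (u @` [set n | (M * k <= n)%N]) _ _ nearB.
  by exists (M * k)%N => // n Mkn; exists n.
pose r := Ordinal (ltn_pmod n k0).
have [_ _] := ABP r; apply/eqP/set0P; exists (u n); split; last exact: Bn.
by rewrite (divn_eq n k) addnC; apply: (MA (n %/ k)%N); rewrite /= leq_divRL.
Qed.

Lemma cvg_residue_cluster (X : topologicalType) (u : nat -> X) r k y :
  (0 < k)%N -> u (r + n * k)%N @[n --> \oo] --> y -> cluster (u @ \oo) y.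
Proof.
move=> k0 uy A B [m _ mA] /uy[M _ MB].
exists (u (r + (M + m) * k)%N); split; last by apply: MB; rewrite /= leq_addr.
by apply: mA => /=; nia.
Qed.

Definition asymptotically_periodic (X : topologicalType) (f : X -> X) (x : X) :=
  exists p k, [/\ (0 < k)%N, iter k f p = p &
    iter (n * k) f x @[n --> \oo] --> p].

Lemma omega_limitE (X : topologicalType) (f : X -> X) x :
  omega_limit f x = cluster (iter n f x @[n --> \oo]).
Proof.
apply/seteqP; split=> y yx.
  move=> A B [m _ mA] /yx/(_ m)[n mn Bn].
  by exists (iter n f x); split => //; exact: mA.
move=> U yU m; have [|_ [[n mn <-] Un]] :=
    yx ((fun n => iter n f x) @` [set n | (m <= n)%N]) U _ yU.
  by exists m => // n mn; exists n.
by exists n.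
Qed.

Lemma asymptotically_periodic_omega_limit (X : topologicalType) (f : X -> X) x :
  hausdorff_space X -> continuous f -> asymptotically_periodic f x ->
  periodic_orbit f (omega_limit f x).
Proof.
move=> hX cf [p [k [k0 fkp xp]]]; exists p, k => //; split => //.
have xrp r : iter (r + n * k) f x @[n --> \oo] --> iter r f p.
  under eq_fun do rewrite iterD.
  by apply: continuous_cvg; [exact: continuous_iter|exact: xp].
rewrite omega_limitE; apply/seteqP; split=> [y xy|_ [r _ <-]].
  have [r /(cvg_cluster (xrp r))/hX ry] := cluster_residue k0 xy.
  by exists r.
exact: cvg_residue_cluster k0 (xrp r).
Qed.

Lemma iter_semiconjugate (X Y : Type) (f : X -> X) (g : Y -> Y) (h : X -> Y) n :
  h \o f =1 g \o h -> h \o iter n f =1 iter n g \o h.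
Proof.
by move=> hfg x; elim: n => //= n <-; exact: hfg.
Qed.

Lemma asymptotically_periodic_semiconjugate (X Y : topologicalType)
    (f : X -> X) (g : Y -> Y) (h : X -> Y) x :
  continuous h -> h \o f =1 g \o h ->
  asymptotically_periodic f x -> asymptotically_periodic g (h x).
Proof.
move=> ch hfg [p [k [k0 fkp xp]]]; exists (h p), k; split=> //.
  by rewrite -[LHS](iter_semiconjugate k hfg p) /= fkp.
under eq_fun => n do rewrite -[iter _ _ _](iter_semiconjugate (n * k) hfg x) /=.
by apply: continuous_cvg; [exact: ch|exact: xp].
Qed.

Lemma asymptotically_periodic_set_type (X : topologicalType) (A : set X)
    (f : X -> X) (fA : A -> A) (a : A) :
  closed A -> (forall b, \val (fA b) = f (\val b)) ->
  asymptotically_periodic f (\val a) -> asymptotically_periodic fA a.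
Proof.
move=> cA fAE [p [k [k0 fkp ap]]].
have iterE n b : \val (iter n fA b) = iter n f (\val b).
  exact: (@iter_semiconjugate A X fA f \val n).
have Ap : A p.
  apply: (closed_cvg _ cA _ _ ap); apply: nearW => n.
  by rewrite -iterE; exact: set_valP.
exists (SigSub (mem_set Ap)), k; split=> //.
  by apply: val_inj; rewrite iterE.
apply: cvg_set_val.
suff : \val (iter (n * k) fA a) @[n --> \oo] --> p by [].
by under eq_fun do rewrite iterE.
Qed.

Section map_fst.
Context (X C : topologicalType).
Implicit Types f : X -> X.

Definition map_fst f (z : X * C) : X * C := (f z.1, z.2).

Lemma continuous_map_fst f : continuous f -> continuous (map_fst f).
Proof.
move=> cf [x c] U [[A B] [/= xA cB] ABU]; exists (f @^-1` A, B) => /=.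
  by split=> //; exact: cf.
by move=> [y d] [Afy Bd]; exact: (ABU (_, _)).
Qed.

Lemma homeomorphism_map_fst f : homeomorphism f -> homeomorphism (map_fst f).
Proof.
move=> [g [fK gK cf cg]]; exists (map_fst g).
split; try exact: continuous_map_fst.
- by case=> x c; rewrite /map_fst/= fK.
- by case=> x c; rewrite /map_fst/= gK.
Qed.

Lemma asymptotically_periodic_map_fst f z :
  asymptotically_periodic f z.1 -> asymptotically_periodic (map_fst f) z.
Proof.
have iterE n y : iter n (map_fst f) y = map_fst (iter n f) y.
  by elim: n => [|n IHn]; [case: y|rewrite iterS IHn].
move=> [p [k [k0 fkp zp]]]; exists (p, z.2), k; split=> //.
  by rewrite iterE /map_fst/= fkp.
under eq_fun do rewrite iterE.
by apply: cvg_pair zp _ => /=; exact: cvg_cst.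
Qed.

End map_fst.

(** * Walks on a finite directed graph *)

Section eventually_periodic.
Context (V : finType).
Implicit Types (f : V -> V) (x : int -> V).

Lemma iter_eventually_periodic f :
  exists m, exists2 k, (0 < k)%N & iter (m + k) f =1 iter m f.
Proof.
pose F (g : {ffun V -> V}) := [ffun v => f (g v)].
have FE n v : iter n F [ffun v => v] v = iter n f v.
  by elim: n => [|n IHn]; rewrite ?iterS ffunE ?IHn.
have /trajectP[m m_lt Fm] := looping_order F [ffun v => v].
exists m, (order F [ffun v => v] - m)%N => [|v]; first by rewrite subn_gt0.
by rewrite subnKC ?(ltnW m_lt)// -!FE Fm.
Qed.

Definition eventually_periodic x :=
  exists J, exists2 k, (0 < k)%N &
    forall j, (J <= j)%R -> x (j + Posz k)%R = x j.

Lemma forward_orbit_eventually_periodic f x J :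
  (forall j, (J <= j)%R -> x (j + 1)%R = f (x j)) -> eventually_periodic x.
Proof.
move=> xf; have [m [k k0 fmk]] := iter_eventually_periodic f.
have xiter n : x (J + Posz n)%R = iter n f (x J).
  elim: n => [|n IHn]; first by rewrite addr0.
  by rewrite -addn1 PoszD addrA xf ?IHn ?addn1// lerDl.
exists (J + Posz m)%R, k => // j jJ.
have [n ->] : exists n, j = (J + Posz m + Posz n)%R.
  by exists (absz (j - J - Posz m)%R); lia.
by rewrite -!addrA -!PoszD !xiter addnCA addnC iterD [RHS]iterD fmk.
Qed.

Lemma backward_orbit_eventually_periodic f x :
  (forall j, x (j - 1)%R = f (x j)) -> eventually_periodic x.
Proof.
move=> xf; have [m [k k0 fmk]] := iter_eventually_periodic f.
have xiter n j : x (j - Posz n)%R = iter n f (x j).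
  elim: n => [|n IHn]; first by rewrite subr0.
  by rewrite -addn1 PoszD opprD addrA xf IHn addn1.
exists 0%R, k => // j _.
have -> : (j + Posz k = j + Posz k + Posz m - Posz m)%R by rewrite addrK.
rewrite xiter -fmk -xiter; congr x; lia.
Qed.

End eventually_periodic.

Definition biseq (V : finType) : Type :=
  prod_topology (fun _ : int => discrete_topology V).

HB.instance Definition _ (V : finType) := Uniform.on (biseq V).
HB.instance Definition _ (R : realType) (V : finType) : @PseudoMetric R _ :=
  @PseudoMetric.on (biseq V).

(* Without this instance, resolution tries [prod_topology_filter], which wants
   the alphabet to be pointed, and diverges. *)
#[global] Instance biseq_nbhs_filter (V : finType) (x : biseq V) :
  ProperFilter (nbhs x) | 0 := nbhs_pfilter x.

Section biseq.
Context (V : finType).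
Implicit Types x : biseq V.

Lemma locally_constant_coord (j : int) : locally_constant (fun x => x j).
Proof.
move=> x.
have := @proj_continuous int (fun=> discrete_topology V) j x [set x j].
by apply; exact: discrete_set1.
Qed.

Lemma cvg_biseq (F : set_system (biseq V)) x : Filter F ->
  (forall j, \forall y \near F, y j = x j) -> F --> x.
Proof.
move=> FF Fx; apply/cvg_sup => j U [B [[C oC <-] Cx BU]].
by apply: filterS (Fx j) => y yj; apply: BU; rewrite /= yj.
Qed.

Lemma compact_biseq : compact [set: biseq V].
Proof.
have cV (_ : int) : compact [set: discrete_topology V].
  by apply: finite_compact; exact: finite_finset.
have := tychonoff cV; congr (compact _).
by apply/seteqP; split.
Qed.

Lemma zero_dimensional_biseq : zero_dimensional (biseq V).
Proof. by apply: zero_dimension_prod => _; exact: discrete_zero_dimension. Qed.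

Definition biseq_shift (n : int) x : biseq V := fun j => x (j + n)%R.

Lemma continuous_biseq_shift n : continuous (biseq_shift n).
Proof.
by move=> x; apply: cvg_biseq => j; exact: (locally_constant_coord (j + n)%R x).
Qed.

Lemma biseq_shiftD m n x :
  biseq_shift m (biseq_shift n x) = biseq_shift (m + n) x.
Proof. by apply/funext => j; rewrite /biseq_shift addrA. Qed.

Lemma biseq_shift0 x : biseq_shift 0 x = x.
Proof. by apply/funext => j; rewrite /biseq_shift addr0. Qed.

Lemma iter_biseq_shift n x : iter n (biseq_shift 1) x = biseq_shift (Posz n) x.
Proof.
elim: n => [|n IHn]; first by rewrite biseq_shift0.
by rewrite iterS IHn biseq_shiftD -PoszD add1n.
Qed.

Lemma eventually_periodic_asymptotically_periodic x :
  eventually_periodic x -> asymptotically_periodic (biseq_shift 1) x.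
Proof.
move=> [J [k k0 xk]].
have xnk j n : (J <= j)%R -> x (j + Posz (n * k))%R = x j.
  move=> Jj; elim: n => [|n IHn]; first by rewrite mul0n addr0.
  rewrite mulSn addnC PoszD addrA xk//.
  by apply: le_trans Jj _; rewrite lerDl.
pose wait (j : int) : nat := absz (J - j)%R.
have le_wait j n : (wait j <= n)%N -> (J <= j + Posz (n * k))%R.
  by rewrite /wait; nia.
pose p : biseq V := fun j => x (j + Posz (wait j * k))%R.
have pE j n : (wait j <= n)%N -> x (j + Posz (n * k))%R = p j.
  by move=> jn; rewrite -(subnKC jn) mulnDl PoszD addrA xnk//; exact: le_wait.
exists p, k; split=> //.
  rewrite iter_biseq_shift; apply/funext => j; rewrite /biseq_shift.
  pose n := maxn (wait j) (wait (j + Posz k)%R).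
  rewrite -(pE j n.+1) -?(pE (j + Posz k)%R n) ?leq_maxr ?leqW ?leq_maxl//.
  by rewrite mulSn PoszD addrA.
under eq_fun do rewrite iter_biseq_shift.
by apply: cvg_biseq => j; exists (wait j) => // n /=; exact: pE.
Qed.

End biseq.

Section walks.
Context (V : finType) (edge : V -> V -> Prop) (next prev : V -> V).
Implicit Types x : biseq V.

(* At most one step [i -> i + 1] of the walk is free: before it the walk is
   dictated backwards by [prev], after it forwards by [next]. Stated over pairs
   [i < j], so that the condition is closed and also holds for the limits in
   which the free step has escaped to infinity. *)
Definition walks : set (biseq V) := [set x |
  (forall j, edge (x j) (x (j + 1)%R)) /\
  (forall i j, (i < j)%R ->
    x (i - 1)%R = prev (x i) \/ x (j + 1)%R = next (x j))].

Lemma closed_walks : closed walks.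
Proof.
move=> x clx.
have agree (js : seq int) : exists2 y, walks y & {in js, forall j, y j = x j}.
  have [|y [yw yjs]] := clx [set y | {in js, forall j, y j = x j}]; last first.
    by exists y.
  elim: js => [|j js IHjs]; first exact: filterE.
  apply: filterS2 (locally_constant_coord j x) IHjs => y yj yjs i.
  by rewrite inE => /predU1P[->|/yjs].
split=> [j|i j ij].
  have [y [Ey _] yx] := agree [:: j; (j + 1)%R].
  by rewrite -!yx ?inE ?eqxx ?orbT.
have [y [_ yP] yx] := agree [:: i; (i - 1)%R; j; (j + 1)%R].
by have := yP _ _ ij; rewrite !yx ?inE ?eqxx ?orbT.
Qed.

Lemma compact_walks : compact [set: walks].
Proof.
apply: compact_set_type; apply: (subclosed_compact _ (@compact_biseq V)) => //.
exact: closed_walks.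
Qed.

Lemma zero_dimensional_walks : zero_dimensional walks.
Proof. exact/zero_dimensional_set_type/zero_dimensional_biseq. Qed.

Lemma walks_biseq_shift n x : walks x -> walks (biseq_shift n x).
Proof.
move=> [xE xP]; split=> [j|i j ij]; rewrite /biseq_shift.
  by rewrite addrAC; exact: xE.
by rewrite !(addrAC _ _ n); apply: xP; rewrite ltrD2r.
Qed.

Definition walk_shift (n : int) (w : walks) : walks :=
  SigSub (mem_set (walks_biseq_shift n (set_valP w))).

Lemma continuous_walk_shift n : continuous (walk_shift n).
Proof.
apply: continuous_comp_initial => w.
apply: (@continuous_comp _ _ _ set_val (biseq_shift n)).
  exact: initial_continuous.
exact: continuous_biseq_shift.
Qed.

Lemma homeomorphism_walk_shift : homeomorphism (walk_shift 1).
Proof.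
exists (walk_shift (-1)); split; try exact: continuous_walk_shift.
- by move=> w; apply: val_inj; rewrite /= biseq_shiftD addNr biseq_shift0.
- by move=> w; apply: val_inj; rewrite /= biseq_shiftD addrN biseq_shift0.
Qed.

Lemma walks_eventually_periodic x : walks x -> eventually_periodic x.
Proof.
move=> [_ xP].
have [[J xnext]|noJ] :=
    pselect (exists J, forall j, (J <= j)%R -> x (j + 1)%R = next (x j)).
  exact: forward_orbit_eventually_periodic xnext.
apply: (@backward_orbit_eventually_periodic _ prev) => i.
apply: contrapT => iprev; apply: noJ; exists (i + 1)%R => j.
by rewrite lezD1 => /xP[].
Qed.

Lemma walk_shift_asymptotically_periodic (w : walks) :
  asymptotically_periodic (walk_shift 1) w.
Proof.
apply: (asymptotically_periodic_set_type (f := biseq_shift 1)) => //.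
  exact: closed_walks.
apply: eventually_periodic_asymptotically_periodic.
exact/walks_eventually_periodic/set_valP.
Qed.

Definition initial_edge (w : walks) : V * V := (\val w 0%R, \val w 1%R).

Lemma locally_constant_initial_edge : locally_constant initial_edge.
Proof.
have lc_coord j : locally_constant (fun w : walks => \val w j).
  apply: (@locally_constant_comp _ _ _ set_val (fun x : biseq V => x j)).
    exact: initial_continuous.
  exact: locally_constant_coord.
exact: locally_constant_pair.
Qed.

Lemma initial_edge_shift w :
  (initial_edge (walk_shift 1 w)).1 = (initial_edge w).2.
Proof. by []. Qed.

Hypotheses (edge_next : forall v, edge v (next v))
  (edge_prev : forall v, edge (prev v) v).

Lemma walk_through_edge i j :
  edge i j -> exists2 x, walks x & x 0%R = i /\ x 1%R = j.
Proof.
move=> ij.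
pose x (n : int) : V :=
  match n with
  | Posz 0 => i
  | Posz n.+1 => iter n next j
  | Negz n => iter n.+1 prev i
  end.
have xprev n : (n <= 0)%R -> x (n - 1)%R = prev (x n).
  case: n => [[|n]|n] // _.
  by have -> : (Negz n - 1)%R = Negz n.+1 by lia.
have xnext n : (0 < n)%R -> x (n + 1)%R = next (x n).
  case: n => [[|n]|n] // _.
  by have -> : (Posz n.+1 + 1)%R = Posz n.+2 by lia.
exists x => //; split=> [n|m n mn].
  have [n0|] := ltrP 0%R n; first by rewrite xnext.
  rewrite le_eqVlt => /predU1P[->//|n0].
  have := xprev (n + 1)%R; rewrite addrK => -> //.
  by rewrite -ltzD1 ltrD2r.
have [m0|m0] := lerP m 0%R; first by left; exact: xprev.
by right; apply: xnext; exact: lt_trans mn.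
Qed.

Lemma range_initial_edge : range initial_edge = [set e | edge e.1 e.2].
Proof.
apply/seteqP; split=> [_ [w _ <-]|[i j] /walk_through_edge[x xw [x0 x1]]].
  by have [wE _] := set_valP w; exact: (wE 0%R).
by exists (SigSub (mem_set xw)) => //; rewrite /initial_edge/= x0 x1.
Qed.

End walks.

(** * Homeomorphisms with prescribed labels *)

(* The Cantor set [K] is a copy of [X * cantor_space], on which [S] acts through
   the first factor. *)
Lemma cantor_extension (R : realType) (I : Type) (X K : pseudoMetricType R)
    (S : X -> X) (e : X -> I) (a : K -> I) :
  compact [set: X] -> zero_dimensional X -> homeomorphism S ->
  locally_constant e ->
  cantor_like K -> [set: K] !=set0 -> locally_constant a -> range a = range e ->
  exists (pi : K -> X) (f : K -> K),
    [/\ homeomorphism f, forall x, e (pi x) = a x,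
        forall x, pi (f x) = S (pi x) &
        forall x, asymptotically_periodic S (pi x) ->
          asymptotically_periodic f x].
Proof.
move=> kX zX homS le cK K0 la rae.
have cXC := cantor_like_prod kX zX cantor_like_cantor_space.
have lefst : locally_constant (e \o @fst X cantor_space).
  by apply: locally_constant_comp le => z; exact: cvg_fst.
have [|h [k [hk eh]]] := labelled_cantor_homeomorphism cK cXC la lefst K0.
  rewrite rae; apply/seteqP; split=> [_ [x _ <-]|_ [z _ <-]].
    by exists (x, point).
  by exists z.1.
have [hK kK ch ck] := hk.
exists (fst \o h), (k \o map_fst S \o h); split=> //.
- exact/(homeomorphism_conjugate hk)/homeomorphism_map_fst.
- by move=> x /=; rewrite kK.
move=> x /asymptotically_periodic_map_fst xper; rewrite -(hK x).
by apply: asymptotically_periodic_semiconjugate xper => // z; rewrite /= kK.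
Qed.

Lemma asymptotically_periodic_homeomorphism (R : realType)
    (K : pseudoMetricType R) (V : finType) (s t : K -> V) :
  cantor_like K -> [set: K] !=set0 ->
  locally_constant s -> locally_constant t ->
  range s = [set: V] -> range t = [set: V] ->
  exists f : K -> K, [/\ homeomorphism f, forall x, s (f x) = t x &
    forall x, asymptotically_periodic f x].
Proof.
move=> cK K0 ls lt sV tV.
pose edge i j := exists2 x, s x = i & t x = j.
have /choice[next edge_next] i : exists j, edge i j.
  by have [x _ sx] : range s i by [rewrite sV]; exists (t x), x.
have /choice[prev edge_prev] j : exists i, edge i j.
  by have [x _ tx] : range t j by [rewrite tV]; exists (s x), x.
have range_edge :
    range (fun x => (s x, t x)) = range (@initial_edge _ edge next prev).
  rewrite range_initial_edge//.
  by apply/seteqP; split=> [_ [x _ <-]|[i j] /= [x <- <-]]; exists x.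
have [pi [f [homf stpi pif fper]]] := cantor_extension
  (@compact_walks V edge next prev) (@zero_dimensional_walks _ _ _ _)
  (@homeomorphism_walk_shift _ _ _ _) (@locally_constant_initial_edge _ _ _ _)
  cK K0 (locally_constant_pair ls lt) range_edge.
exists f; split=> // x.
  by have := initial_edge_shift (pi x); rewrite -pif !stpi.
by apply: fper; exact: walk_shift_asymptotically_periodic.
Qed.

Theorem theorem4p1 (R : realType) (K : metricType R) (T : K -> K)
    (N : nat) (Ks : 'I_N -> set K) :
  is_cantor_set [set: K] ->
  homeomorphism T ->
  (forall i, is_cantor_set (Ks i)) ->
  (forall i j, i != j -> Ks i `&` Ks j = set0) ->
  \bigcup_i Ks i = [set: K] ->
  exists Tt : K -> K,
    [/\ homeomorphism Tt,
        (forall (x : K) (i : 'I_N), Ks i (Tt x) <-> Ks i (T x)) &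
        (forall x : K, periodic_orbit Tt (omega_limit Tt x))].
Proof.
move=> cantorK [T' [_ T'K cT _]] cantorKs disjKs covKs.
have cKs i : closed (Ks i) by have [_ _ []] := cantorKs i.
have [|l lE lcl] := partition_locally_constant cKs _ covKs.
  by apply/trivIsetP => i j _ _; exact: disjKs.
have l_surj : range l = [set: 'I_N].
  apply/seteqP; split=> // i _.
  by have [[x /lE lx] _ _ _] := cantorKs i; exists x.
have lT_surj : range (l \o T) = [set: 'I_N].
  apply/seteqP; split=> // i; rewrite -l_surj => -[x _ <-].
  by exists (T' x); rewrite //= T'K.
have hK : hausdorff_space K by exact: metric_hausdorff.
have cK := cantor_set_cantor_like hK cantorK; have [K0 _ _ _] := cantorK.
have [Tt [homTt lTt Tt_per]] := asymptotically_periodic_homeomorphism cK K0 lcl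
  (locally_constant_comp cT lcl) l_surj lT_surj.
exists Tt; split=> // [x i|x].
  by split=> /lE xi; apply/lE; rewrite -xi lTt.
apply: asymptotically_periodic_omega_limit => //.
by have [? []] := homTt.
Qed.
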